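(* Let $q$ be a complex number with $0<|q|<1$. For all nonnegative integers $m$, $$\sum_{k\ge m+1} {2k \brack k}_{q^2}\,\frac{q^k}{(-q;q)_{2k}\,[k-m]_{q^2}} = {2m \brack m}_{q^2}\,\frac{(1+q)\,q^m}{(-q;q)_{2m}} \left(\sum_{k\ge 1} \frac{q^{2k-1}}{[2k-1]_q} - \sum_{k\ge 1} \frac{q^{2k+2m}}{[2k+2m]_q}\right).$$
   Context: For a base $p$ (here $p=q$ or $p=q^2$): The $q$-Pochhammer symbol is $(a;p)_N:=\prod_{j=0}^{N-1}(1-ap^j)$ for nonnegative integers $N$, so that $(-q;q)_{2k}=\prod_{j=1}^{2k}(1+q^j)$. The $q$-binomial coefficient is ${n \brack m}_p:=\dfrac{(p;p)_n}{(p;p)_m(p;p)_{n-m}}$ if $0\le m\le n$, and $0$ otherwise. The $q$-integer is $[n]_p:=\dfrac{1-p^n}{1-p}$; in particular $[k-m]_{q^2}=\dfrac{1-q^{2k-2m}}{1-q^2}$. Infinite sums are convergent series of complex numbers. *)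

(* Defs.v *)
From Stdlib Require Import Reals Arith.
From Coquelicot Require Import Coquelicot.

Local Open Scope C_scope.

(* (a; p)_N = (1 - a) (1 - a p) ... (1 - a p^(N-1)) *)
Fixpoint qpoch (a p : C) (N : nat) : C :=
  match N with
  | O => 1
  | S j => qpoch a p j * (1 - a * p ^ j)
  end.

Definition qbinom (p : C) (n m : nat) : C :=
  if Nat.leb m n then
    qpoch p p n / (qpoch p p m * qpoch p p (n - m))
  else 0.

Definition qint (p : C) (n : nat) : C := (1 - p ^ n) / (1 - p).

(* The series a n0 + a (n0 + 1) + ... converges in C, with sum s. *)
Definition is_sum_from (n0 : nat) (a : nat -> C) (s : C) : Prop :=
  is_series (fun j : nat => a (n0 + j)%nat) s.

(* Main.v *)
Require Import Defs.
From Stdlib Require Import Reals Arith Lra Lia.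
From Coquelicot Require Import Coquelicot.

(** Since [(q^2;q^2)_2k = (q;q)_2k (-q;q)_2k] and
    [(q;q)_2k = (q;q^2)_k (q^2;q^2)_k], the factor
    [qbinom (q^2) (2k) k / (-q;q)_2k] is just [(q;q^2)_k / (q^2;q^2)_k]
    ([central_qbinom]).  Put [x = q], [p = q^2], [a = q^(2m+1)] and
    [k = m + j].  Dividing by the value at [k = m] leaves
    [(a;p)_j / (xa;p)_j], and the theorem becomes an instance of

      Phi(a) := sum_{j >= 1} (a;p)_j / (xa;p)_j * x^j / (1 - p^j)
              = sum_{i >= 0} x p^i / (1 - x p^i)
                - sum_{i >= 0} x a p^i / (1 - x a p^i),

    valid for [|x| < 1], [|p| < 1], [|a| <= 1] ([q_gauss_log_derivative]).
    It is the derivative at [b = 1] of the q-Gauss summation of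
    2phi1(a, b; c; p, c/(ab)) with [c = xa], but it has a direct proof:

    - The difference of the terms of [Phi(ap)] and [Phi(a)] telescopes, and
      gives [Phi(ap) - Phi(a) = x a / (1 - x a)] ([gauss_series_step]).
      Iterating, [Phi(a p^n)] is [Phi(a)] plus a partial sum of the last
      series above.
    - [(a;p)_j / (xa;p)_j] tends to 1 as [a -> 0], uniformly in [j]
      ([Cmod_qpoch_ratio_minus_1_le]).  So [Phi(a p^n)] tends to
      [Phi(0) = sum_{j >= 1} x^j / (1 - p^j)] ([gauss_series_near]), which
      both proves that the last series converges and finds its sum.
    - [Phi(0)] equals [sum_{i >= 0} x p^i / (1 - x p^i)]: both are the double
      series of [x^j p^(ij)], summed by rows or by columns
      ([is_series_lambert]). *)

Local Open Scope C_scope.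

(** * Convergence of complex series *)

(** Reduces convergence in [C] to that of a real sequence, so that the real
    squeeze theorem applies. *)
Lemma is_series_Cmod (u : nat -> C) (l : C) :
  is_series u l <-> is_lim_seq (fun n => Cmod (sum_n u n - l)) 0%R.
Proof.
  unfold is_series.
  rewrite (filterlim_locally_ball_norm (sum_n u) l), <- is_lim_seq_spec.
  split; intros H eps; specialize (H eps); revert H; apply filter_imp;
    intros n Hn.
  - rewrite Rminus_0_r, Rabs_pos_eq by apply Cmod_ge_0. exact Hn.
  - rewrite Rminus_0_r, Rabs_pos_eq in Hn by apply Cmod_ge_0. exact Hn.
Qed.

Lemma is_series_of_le (u : nat -> C) (l : C) (e : nat -> R) :
  (forall n, (Cmod (sum_n u n - l) <= e n)%R) -> is_lim_seq e 0%R ->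
  is_series u l.
Proof.
  intros H He; apply is_series_Cmod, (is_lim_seq_le_le (fun _ => 0%R) _ e).
  - intros n; split; [apply Cmod_ge_0 | apply H].
  - apply is_lim_seq_const.
  - exact He.
Qed.

Lemma Cmod_sum_n_le (u : nat -> C) (v : nat -> R) (n : nat) :
  (forall k, (Cmod (u k) <= v k)%R) -> (Cmod (sum_n u n) <= sum_n v n)%R.
Proof.
  intros H; induction n as [|n IH]; [rewrite !sum_O; apply H|].
  rewrite !sum_Sn; eapply Rle_trans; [apply Cmod_triangle|].
  apply Rplus_le_compat; auto.
Qed.

Lemma Cmod_sum_n_le_series (u : nat -> C) (v : nat -> R) (V : R) (n : nat) :
  (forall k, (Cmod (u k) <= v k)%R) -> is_series v V ->
  (Cmod (sum_n u n) <= V)%R.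
Proof.
  intros H HV; eapply Rle_trans; [apply Cmod_sum_n_le, H|].
  apply (is_lim_seq_incr_compare (sum_n v)); [exact HV|].
  intros k; rewrite sum_Sn. specialize (H (S k)).
  pose proof (Cmod_ge_0 (u (S k))); unfold plus; simpl; lra.
Qed.

Lemma Cmod_series_le (u : nat -> C) (s : C) (v : nat -> R) (V : R) :
  (forall k, (Cmod (u k) <= v k)%R) -> is_series u s -> is_series v V ->
  (Cmod s <= V)%R.
Proof.
  intros H Hu Hv; apply is_series_Cmod in Hu.
  apply (is_lim_seq_le (fun _ => Cmod s)
           (fun n => Cmod (sum_n u n - s) + V)%R (Cmod s) V).
  - intros n. pose proof (Cmod_sum_n_le_series u v V n H Hv).
    pose proof (Cmod_triangle (s - sum_n u n) (sum_n u n)) as T.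
    replace (s - sum_n u n + sum_n u n) with s in T by ring.
    replace (s - sum_n u n) with (- (sum_n u n - s)) in T by ring.
    rewrite Cmod_opp in T; lra.
  - apply is_lim_seq_const.
  - replace (Finite V) with (Rbar_plus 0%R V) by (simpl; f_equal; ring).
    apply is_lim_seq_plus'; [exact Hu | apply is_lim_seq_const].
Qed.

Lemma ex_series_C_le (u : nat -> C) (v : nat -> R) :
  (forall k, (Cmod (u k) <= v k)%R) -> ex_series v ->
  exists s : C, is_series u s.
Proof.
  intros H Hv.
  exact (@ex_series_le C_AbsRing C_CompleteNormedModule u v H Hv).
Qed.

(** * Finite sums and estimates in the unit disc *)

Lemma sum_n_C_scal (c : C) (u : nat -> C) (n : nat) :
  sum_n (fun k => c * u k) n = c * sum_n u n.
Proof. exact (sum_n_mult_l (K := C_Ring) c u n). Qed.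

Lemma sum_n_C_minus (u v : nat -> C) (n : nat) :
  sum_n (fun k => u k - v k) n = sum_n u n - sum_n v n.
Proof.
  induction n as [|n IH]; [now rewrite !sum_O|].
  rewrite !sum_Sn, IH; unfold plus; simpl; ring.
Qed.

Lemma sum_n_telescope (H : nat -> C) (n : nat) :
  sum_n (fun j => H j - H (S j)) n = H 0%nat - H (S n).
Proof.
  induction n as [|n IH]; [now rewrite sum_O|].
  rewrite sum_Sn, IH; unfold plus; simpl; ring.
Qed.

Lemma is_series_C_scal (c : C) (u : nat -> C) (s : C) :
  is_series u s -> is_series (fun n => c * u n) (c * s).
Proof. exact (is_series_scal (K := C_AbsRing) (V := C_NormedModule) c u s). Qed.

Lemma is_series_C_plus (u v : nat -> C) (s t : C) :
  is_series u s -> is_series v t -> is_series (fun n => u n + v n) (s + t).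
Proof. exact (is_series_plus (K := C_AbsRing) (V := C_NormedModule) u v s t). Qed.

Lemma sum_n_geom (z : C) (n : nat) :
  (1 - z) * sum_n (fun i => z ^ i) n = 1 - z ^ S n.
Proof.
  induction n as [|n IH]; [rewrite sum_O, Cpow_S; simpl; ring|].
  rewrite sum_Sn; unfold plus; simpl.
  replace ((1 - z) * (sum_n (fun i => z ^ i) n + z * z ^ n))
    with ((1 - z) * sum_n (fun i => z ^ i) n + (1 - z) * (z * z ^ n)) by ring.
  rewrite IH, Cpow_S; ring.
Qed.

(** The remainder of a geometric series with first term [X] and ratio [z],
    when [s] is a partial sum of the powers of [z] and [Q] the first power left
    out. *)
Lemma geom_remainder (X z s Q : C) :
  1 - z <> 0 -> (1 - z) * s = 1 - Q -> X / (1 - z) - X * s = X * Q / (1 - z).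
Proof.
  intros D G. replace Q with (1 - (1 - z) * s) by (rewrite G; ring).
  field; exact D.
Qed.

Lemma Cmod_1_minus_ge (z : C) : (1 - Cmod z <= Cmod (1 - z))%R.
Proof.
  pose proof (Cmod_triangle (1 - z) z) as T.
  replace (1 - z + z) with (RtoC 1) in T by ring. rewrite Cmod_1 in T. lra.
Qed.

Lemma one_minus_neq_0 (z : C) : (Cmod z < 1)%R -> 1 - z <> 0.
Proof.
  intros H; apply Cmod_gt_0. pose proof (Cmod_1_minus_ge z); lra.
Qed.

Lemma Cmod_div_one_minus_le (y z : C) (Y r : R) :
  (Cmod y <= Y)%R -> (Cmod z <= r)%R -> (r < 1)%R ->
  (Cmod (y / (1 - z)) <= Y / (1 - r))%R.
Proof.
  intros Hy Hz Hr. pose proof (Cmod_1_minus_ge z).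
  rewrite Cmod_div by (apply one_minus_neq_0; lra).
  apply Rmult_le_compat; [apply Cmod_ge_0 | | exact Hy |].
  - apply Rlt_le, Rinv_0_lt_compat; lra.
  - apply Rinv_le_contravar; lra.
Qed.

Lemma pow_le_1_compat (r : R) (n : nat) : (0 <= r <= 1 -> 0 <= r ^ n <= 1)%R.
Proof.
  intros H; split; [apply pow_le; lra|].
  rewrite <- (pow1 n); apply pow_incr; lra.
Qed.

Lemma Cmod_mul_pow_le (c p : C) (n : nat) :
  (Cmod p <= 1)%R -> (Cmod (c * p ^ n) <= Cmod c)%R.
Proof.
  intros Hp. rewrite Cmod_mult, Cmod_pow.
  pose proof (Cmod_ge_0 c).
  pose proof (pow_le_1_compat _ n (conj (Cmod_ge_0 p) Hp)); nra.
Qed.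

Lemma Cmod_pow_S_le (p : C) (n : nat) :
  (Cmod p <= 1)%R -> (Cmod (p ^ S n) <= Cmod p)%R.
Proof.
  intros H; rewrite Cpow_S, Cmod_mult, Cmod_pow.
  pose proof (Cmod_ge_0 p).
  pose proof (pow_le_1_compat (Cmod p) n (conj H0 H)). nra.
Qed.

Lemma is_series_Cmod_geom (z : C) :
  (Cmod z < 1)%R -> is_series (fun n => Cmod z ^ n)%R (/ (1 - Cmod z))%R.
Proof.
  intros H; apply is_series_geom. rewrite Rabs_pos_eq; auto using Cmod_ge_0.
Qed.

Lemma is_series_R_scal (c : R) (u : nat -> R) (s : R) :
  is_series u s -> is_series (fun n => c * u n)%R (c * s)%R.
Proof. exact (is_series_scal c u s). Qed.

Lemma is_lim_seq_Cmod_pow (K : R) (z : C) :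
  (Cmod z < 1)%R -> is_lim_seq (fun n => K * Cmod z ^ n)%R 0%R.
Proof.
  intros H. replace (Finite 0%R) with (Rbar_mult K 0%R)
    by (simpl; f_equal; ring).
  apply is_lim_seq_scal_l, is_lim_seq_geom.
  rewrite Rabs_pos_eq; auto using Cmod_ge_0.
Qed.

(** * Two expansions of a Lambert series *)

Section Lambert.
Context (x p : C) (Hx : (Cmod x < 1)%R) (Hp : (Cmod p < 1)%R).

Lemma lambert_row_remainder (n j : nat) :
  x ^ S j / (1 - p ^ S j) - sum_n (fun i => x ^ S j * (p ^ S j) ^ i) n
  = x ^ S j * (p ^ S n) ^ S j / (1 - p ^ S j).
Proof using Hp.
  pose proof (sum_n_geom (p ^ S j) n) as G.
  assert (1 - p ^ S j <> 0) as D.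
  { apply one_minus_neq_0; pose proof (Cmod_pow_S_le p j); lra. }
  rewrite sum_n_C_scal.
  replace ((p ^ S n) ^ S j) with ((p ^ S j) ^ S n)
    by (rewrite <- !Cpow_mult_r; f_equal; lia).
  now apply geom_remainder.
Qed.

Lemma lambert_col_remainder (n i : nat) :
  x * p ^ i / (1 - x * p ^ i) - sum_n (fun j => x ^ S j * (p ^ S j) ^ i) n
  = x * p ^ i * (x * p ^ i) ^ S n / (1 - x * p ^ i).
Proof using Hx Hp.
  pose proof (sum_n_geom (x * p ^ i) n) as G.
  assert (1 - x * p ^ i <> 0) as D.
  { apply one_minus_neq_0; pose proof (Cmod_mul_pow_le x p i); lra. }
  rewrite (sum_n_ext _ (fun j => x * p ^ i * (x * p ^ i) ^ j)).
  2:{ intros j. rewrite <- Cpow_mult_r, Nat.mul_comm, Cpow_mult_r.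
      rewrite <- Cpow_mult_l.
      replace (x * p ^ i * (x * p ^ i) ^ j) with ((x * p ^ i) ^ S j)
        by now rewrite Cpow_S.
      reflexivity. }
  rewrite sum_n_C_scal. now apply geom_remainder.
Qed.

Lemma lambert_term_le (j : nat) :
  (Cmod (x ^ S j / (1 - p ^ S j)) <= / (1 - Cmod p) * Cmod x ^ j)%R.
Proof using Hx Hp.
  rewrite Rmult_comm. apply Cmod_div_one_minus_le; [| |lra].
  - rewrite Cpow_S, Cmod_mult, Cmod_pow.
    pose proof (Cmod_ge_0 x). pose proof (pow_le (Cmod x) j H). nra.
  - apply Cmod_pow_S_le; lra.
Qed.

(* The sum of the double geometric series of [|x|^j |p|^i]. *)
Let K := (/ (1 - Cmod p) * / (1 - Cmod x))%R.

Lemma lambert_row_bound (n : nat) :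
  (Cmod (sum_n (fun j => (x ^ S j * (p ^ S n) ^ S j / (1 - p ^ S j))%C) n)
   <= K * Cmod p ^ n)%R.
Proof using Hx Hp.
  replace (K * Cmod p ^ n)%R
    with (/ (1 - Cmod p) * Cmod p ^ n * / (1 - Cmod x))%R by (unfold K; ring).
  apply (Cmod_sum_n_le_series _
           (fun j => / (1 - Cmod p) * Cmod p ^ n * Cmod x ^ j)%R).
  2: now apply is_series_R_scal, is_series_Cmod_geom.
  intros j.
  replace (x ^ S j * (p ^ S n) ^ S j / (1 - p ^ S j))%C
    with ((p ^ S n) ^ S j * (x ^ S j / (1 - p ^ S j)))%C by (unfold Cdiv; ring).
  rewrite Cmod_mult. pose proof (lambert_term_le j) as HT.
  assert (Cmod ((p ^ S n) ^ S j) <= Cmod p ^ n)%R as HP.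
  { eapply Rle_trans; [apply Cmod_pow_S_le|].
    - eapply Rle_trans; [apply Cmod_pow_S_le|]; lra.
    - rewrite Cmod_pow. simpl. pose proof (Cmod_ge_0 p).
      pose proof (pow_le (Cmod p) n H). nra. }
  replace (/ (1 - Cmod p) * Cmod p ^ n * Cmod x ^ j)%R
    with (Cmod p ^ n * (/ (1 - Cmod p) * Cmod x ^ j))%R by ring.
  apply Rmult_le_compat; auto using Cmod_ge_0.
Qed.

Lemma lambert_col_bound (n : nat) :
  (Cmod (sum_n (fun i => (x * p ^ i * (x * p ^ i) ^ S n / (1 - x * p ^ i))%C) n)
   <= K * Cmod x ^ n)%R.
Proof using Hx Hp.
  replace (K * Cmod x ^ n)%R
    with (/ (1 - Cmod x) * Cmod x ^ n * / (1 - Cmod p))%R by (unfold K; ring).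
  apply (Cmod_sum_n_le_series _
           (fun j => / (1 - Cmod x) * Cmod x ^ n * Cmod p ^ j)%R).
  2: now apply is_series_R_scal, is_series_Cmod_geom.
  intros i. pose proof (Cmod_mul_pow_le x p i (Rlt_le _ _ Hp)) as Hi.
  replace (/ (1 - Cmod x) * Cmod x ^ n * Cmod p ^ i)%R
    with (Cmod p ^ i * Cmod x ^ n / (1 - Cmod x))%R by (unfold Rdiv; ring).
  apply Cmod_div_one_minus_le; auto.
  rewrite Cmod_mult.
  pose proof (Cmod_ge_0 x) as X0. pose proof (Cmod_ge_0 p) as P0.
  pose proof (pow_le (Cmod p) i P0).
  apply Rmult_le_compat; auto using Cmod_ge_0.
  - rewrite Cmod_mult, Cmod_pow. nra.
  - rewrite Cmod_pow. simpl.
    pose proof (Cmod_ge_0 (x * p ^ i)) as Y0.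
    assert (Cmod (x * p ^ i) ^ n <= Cmod x ^ n)%R by (apply pow_incr; lra).
    pose proof (pow_le _ n Y0). nra.
Qed.

(** The square block of the double series of [x^(j+1) p^((j+1)i)] with [i, j <= n]
    differs from the [n]-th partial sum of either series by the tails of [n + 1]
    geometric series; these add up to at most [K |p|^n] for the rows and
    [K |x|^n] for the columns.  Comparing with finite blocks avoids any
    rearrangement of infinite sums. *)
Lemma is_series_lambert (L : C) :
  is_series (fun j => x ^ S j / (1 - p ^ S j)) L ->
  is_series (fun i => x * p ^ i / (1 - x * p ^ i)) L.
Proof using Hx Hp.
  intros HL. apply is_series_Cmod in HL.
  apply (is_series_of_le _ _ (fun n =>
    (Cmod (sum_n (fun j => (x ^ S j / (1 - p ^ S j))%C) n - L)
     + (K * Cmod p ^ n + K * Cmod x ^ n))%R)).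
  - intros n.
    pose proof (lambert_row_bound n) as HR.
    pose proof (lambert_col_bound n) as HC.
    rewrite <- (sum_n_ext _ _ n (lambert_row_remainder n)), sum_n_C_minus in HR.
    rewrite <- (sum_n_ext _ _ n (lambert_col_remainder n)), sum_n_C_minus in HC.
    rewrite sum_n_switch in HR.
    match type of HR with (Cmod (?A - ?D) <= _)%R =>
      match type of HC with (Cmod (?B - D) <= _)%R =>
        replace (B - L) with ((A - L) + (- (A - D) + (B - D))) by ring
      end
    end.
    eapply Rle_trans; [apply Cmod_triangle|]. apply Rplus_le_compat_l.
    eapply Rle_trans; [apply Cmod_triangle|]. rewrite Cmod_opp. lra.
  - replace (Finite 0%R) with (Rbar_plus 0%R 0%R) by (simpl; f_equal; ring).
    apply is_lim_seq_plus'; [exact HL|].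
    replace 0%R with (0 + 0)%R by ring.
    apply is_lim_seq_plus'; now apply is_lim_seq_Cmod_pow.
Qed.

End Lambert.

(** * Ratios of q-Pochhammer symbols *)

Lemma qpoch_add (a p : C) (m n : nat) :
  qpoch a p (m + n) = qpoch a p m * qpoch (a * p ^ m) p n.
Proof.
  induction n as [|n IH].
  - rewrite Nat.add_0_r; simpl; ring.
  - rewrite Nat.add_succ_r; simpl qpoch. rewrite IH, Cpow_add_r. ring.
Qed.

Lemma qpoch_S_l (a p : C) (n : nat) :
  qpoch a p (S n) = (1 - a) * qpoch (a * p) p n.
Proof.
  change (S n) with (1 + n)%nat. rewrite qpoch_add, Cpow_1_r. simpl. ring.
Qed.

Lemma qpoch_neq_0 (c p : C) (n : nat) :
  (Cmod c < 1)%R -> (Cmod p <= 1)%R -> qpoch c p n <> 0.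
Proof.
  intros Hc Hp; induction n as [|n IH]; simpl.
  - apply C1_nz.
  - apply Cmult_neq_0; [exact IH|]. apply one_minus_neq_0.
    pose proof (Cmod_mul_pow_le c p n Hp); lra.
Qed.

Definition qpoch_ratio (x p a : C) (n : nat) : C := qpoch a p n / qpoch (x * a) p n.

(** The summand of [Phi(a)] for the index [j + 1]; the summand of index 0 would be
    singular. *)
Definition gauss_term (x p a : C) (j : nat) : C :=
  qpoch_ratio x p a (S j) * (x ^ S j / (1 - p ^ S j)).

(** * The logarithmic derivative of the q-Gauss sum *)

Section Gauss.
Context (x p : C) (Hx : (Cmod x < 1)%R) (Hp : (Cmod p < 1)%R).

Lemma Cmod_xa_le (a : C) : (Cmod a <= 1)%R -> (Cmod (x * a) <= Cmod x)%R.
Proof using.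
  intros Ha; rewrite Cmod_mult.
  pose proof (Cmod_ge_0 x). pose proof (Cmod_ge_0 a). nra.
Qed.

Lemma Cmod_xap_le (a : C) (n : nat) :
  (Cmod a <= 1)%R -> (Cmod (x * a * p ^ n) <= Cmod x)%R.
Proof using Hp.
  intros Ha. pose proof (Cmod_xa_le a Ha).
  pose proof (Cmod_mul_pow_le (x * a) p n). lra.
Qed.

Lemma qpoch_ratio_S (a : C) (n : nat) : (Cmod a <= 1)%R ->
  qpoch_ratio x p a (S n)
  = qpoch_ratio x p a n * ((1 - a * p ^ n) / (1 - x * a * p ^ n)).
Proof using Hx Hp.
  intros Ha. unfold qpoch_ratio. simpl qpoch. field. split.
  - apply one_minus_neq_0. pose proof (Cmod_xap_le a n Ha). lra.
  - apply qpoch_neq_0; [|lra]. pose proof (Cmod_xa_le a Ha). lra.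
Qed.

Lemma Cmod_ap_le (a : C) : (Cmod a <= 1)%R -> (Cmod (a * p) <= 1)%R.
Proof using Hp.
  intros Ha; rewrite Cmod_mult.
  pose proof (Cmod_ge_0 p). pose proof (Cmod_ge_0 a). nra.
Qed.

Lemma qpoch_ratio_S_l (a : C) (n : nat) : (Cmod a <= 1)%R ->
  qpoch_ratio x p a (S n) = (1 - a) / (1 - x * a) * qpoch_ratio x p (a * p) n.
Proof using Hx Hp.
  intros Ha. unfold qpoch_ratio. rewrite !qpoch_S_l.
  replace (x * (a * p)) with (x * a * p) by ring.
  field. split.
  - apply qpoch_neq_0; [|lra].
    replace (x * a * p) with (x * (a * p)) by ring.
    pose proof (Cmod_xa_le (a * p) (Cmod_ap_le a Ha)). lra.
  - apply one_minus_neq_0. pose proof (Cmod_xa_le a Ha). lra.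
Qed.

(* [K |a|] bounds the sum over [n] of the distances to 1 of the factors
   [(1 - a p^n) / (1 - x a p^n)]. *)
Let K := (2 / ((1 - Cmod x) * (1 - Cmod p)))%R.

(** A product of factors [1 + e_i] differs from 1 by at most
    [exp (sum |e_i|) - 1]; here [|e_i| <= 2 |a| |p|^i / (1 - |x|)], and the
    partial geometric sum is kept exact so that the induction closes. *)
Lemma Cmod_qpoch_ratio_minus_1_exp (a : C) (n : nat) : (Cmod a <= 1)%R ->
  (Cmod (qpoch_ratio x p a n - 1) <= exp (K * Cmod a * (1 - Cmod p ^ n)) - 1)%R.
Proof using Hx Hp.
  intros Ha. induction n as [|n IH].
  - unfold qpoch_ratio; simpl. replace (1 / 1 - 1) with (RtoC 0) by (field; apply C1_nz).
    rewrite Cmod_0. rewrite Rminus_diag, Rmult_0_r, exp_0. lra.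
  - set (e := (a * p ^ n * (x - 1) / (1 - x * a * p ^ n))).
    pose proof (Cmod_xap_le a n Ha) as Hc.
    assert (1 - x * a * p ^ n <> 0) as D by (apply one_minus_neq_0; lra).
    replace (qpoch_ratio x p a (S n) - 1)
      with ((qpoch_ratio x p a n - 1) * (1 + e) + e).
    2:{ rewrite qpoch_ratio_S by exact Ha. unfold e. field. exact D. }
    set (d := (2 * (Cmod a * Cmod p ^ n) / (1 - Cmod x))%R).
    assert (Cmod e <= d)%R as He.
    { apply Cmod_div_one_minus_le; [|exact Hc|exact Hx].
      rewrite !Cmod_mult, Cmod_pow, Rmult_comm.
      apply Rmult_le_compat_r.
      - apply Rmult_le_pos; [apply Cmod_ge_0|apply pow_le, Cmod_ge_0].
      - pose proof (Cmod_triangle x (- (1))) as T.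
        rewrite Cmod_opp, Cmod_1 in T. unfold Cminus. lra. }
    replace (K * Cmod a * (1 - Cmod p ^ S n))%R
      with (K * Cmod a * (1 - Cmod p ^ n) + d)%R.
    2:{ unfold K, d; simpl; field. lra. }
    rewrite exp_plus. set (E := exp (K * Cmod a * (1 - Cmod p ^ n))) in *.
    assert (0 < E)%R by apply exp_pos.
    pose proof (exp_ineq1_le d). pose proof (Cmod_ge_0 e).
    pose proof (Cmod_ge_0 (qpoch_ratio x p a n - 1)).
    eapply Rle_trans; [apply Cmod_triangle|]. rewrite Cmod_mult.
    pose proof (Cmod_triangle 1 e) as T. rewrite Cmod_1 in T.
    assert (Cmod (qpoch_ratio x p a n - 1) * Cmod (1 + e) <= (E - 1) * (1 + d))%R.
    { apply Rmult_le_compat; auto using Cmod_ge_0. lra. }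
    nra.
Qed.

Let B := (K * exp K)%R.

Lemma K_pos : (0 < K)%R.
Proof using Hx Hp.
  apply Rdiv_lt_0_compat; [lra|]. apply Rmult_lt_0_compat; lra.
Qed.

Lemma B_pos : (0 < B)%R.
Proof using Hx Hp.
  apply Rmult_lt_0_compat; [apply K_pos | apply exp_pos].
Qed.

(** From the exponential bound, by [exp t - 1 <= t exp t].  It is linear in [a]
    and uniform in [n]: this is what allows [a -> 0] under the sum. *)
Lemma Cmod_qpoch_ratio_minus_1_le (a : C) (n : nat) : (Cmod a <= 1)%R ->
  (Cmod (qpoch_ratio x p a n - 1) <= B * Cmod a)%R.
Proof using Hx Hp.
  intros Ha. eapply Rle_trans; [apply Cmod_qpoch_ratio_minus_1_exp, Ha|].
  set (t := (K * Cmod a * (1 - Cmod p ^ n))%R).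
  pose proof K_pos as HK. pose proof (Cmod_ge_0 a) as A0.
  assert (0 <= Cmod p <= 1)%R as P by (split; [apply Cmod_ge_0|lra]).
  pose proof (pow_le_1_compat _ n P) as Pn.
  assert (0 <= K * Cmod a)%R by nra.
  assert (0 <= t <= K * Cmod a)%R as Ht by (unfold t; nra).
  assert (K * Cmod a <= K)%R by nra.
  assert (exp t <= exp K)%R as HE.
  { destruct (Req_dec t K) as [->|]; [lra|]. apply Rlt_le, exp_increasing; lra. }
  pose proof (exp_ineq1_le (- t)) as HN.
  assert (exp t * exp (- t) = 1)%R as HI by (rewrite <- exp_plus, Rplus_opp_r, exp_0; ring).
  pose proof (exp_pos t).
  assert (exp t - 1 <= t * exp t)%R by nra.
  assert (t * exp t <= K * Cmod a * exp K)%R by (apply Rmult_le_compat; lra).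
  unfold B; lra.
Qed.

Lemma Cmod_qpoch_ratio_le (a : C) (n : nat) : (Cmod a <= 1)%R ->
  (Cmod (qpoch_ratio x p a n) <= 1 + B)%R.
Proof using Hx Hp.
  intros Ha. pose proof (Cmod_qpoch_ratio_minus_1_le a n Ha).
  pose proof (Cmod_triangle (qpoch_ratio x p a n - 1) 1) as T.
  replace (qpoch_ratio x p a n - 1 + 1) with (qpoch_ratio x p a n) in T by ring.
  rewrite Cmod_1 in T. pose proof B_pos. pose proof (Cmod_ge_0 a). nra.
Qed.

(** With [r = (ap;p)_j / (xap;p)_j] and [P = p^(j+1)], the ratios in the two terms
    are [r (1 - aP) / (1 - xaP)] and [r (1 - a) / (1 - xa)].  Their difference
    has the factor [1 - P], which cancels the denominator of the summand, and
    what remains is a difference of consecutive values of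
    [x a / (1 - x a) * r * x^j]. *)
Lemma gauss_term_step (a : C) (j : nat) : (Cmod a <= 1)%R ->
  gauss_term x p (a * p) j - gauss_term x p a j
  = x * a / (1 - x * a) * (qpoch_ratio x p (a * p) j * x ^ j)
    - x * a / (1 - x * a) * (qpoch_ratio x p (a * p) (S j) * x ^ S j).
Proof using Hx Hp.
  intros Ha. unfold gauss_term.
  rewrite (qpoch_ratio_S_l a) by exact Ha.
  rewrite (qpoch_ratio_S (a * p)) by now apply Cmod_ap_le.
  assert (1 - x * a <> 0) as D1.
  { apply one_minus_neq_0. pose proof (Cmod_xa_le a Ha). lra. }
  assert (1 - p ^ S j <> 0) as D2.
  { apply one_minus_neq_0. pose proof (Cmod_pow_S_le p j). lra. }
  assert (1 - x * a * p ^ S j <> 0) as D3.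
  { apply one_minus_neq_0. pose proof (Cmod_xap_le a (S j) Ha). lra. }
  replace (a * p * p ^ j) with (a * p ^ S j) by (rewrite Cpow_S; ring).
  replace (x * (a * p) * p ^ j) with (x * a * p ^ S j) by (rewrite Cpow_S; ring).
  rewrite (Cpow_S x).
  revert D2 D3. generalize (p ^ S j) (x ^ j) (qpoch_ratio x p (a * p) j).
  intros P X r D2 D3. field. auto.
Qed.

Lemma gauss_series_step (a s : C) : (Cmod a <= 1)%R ->
  is_series (gauss_term x p a) s ->
  is_series (gauss_term x p (a * p)) (s + x * a / (1 - x * a)).
Proof using Hx Hp.
  intros Ha Hs.
  set (c := x * a / (1 - x * a)).
  set (H := fun j => c * (qpoch_ratio x p (a * p) j * x ^ j)).
  apply (is_series_ext (fun j => gauss_term x p a j + (H j - H (S j)))).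
  { intros j. unfold H, c. rewrite <- gauss_term_step by exact Ha.
    change (gauss_term x p a j + (gauss_term x p (a * p) j - gauss_term x p a j)
            = gauss_term x p (a * p) j). ring. }
  apply is_series_C_plus; [exact Hs|].
  apply (is_series_of_le _ _ (fun n => (Cmod c * (1 + B) * Cmod x ^ n)%R)).
  2: now apply is_lim_seq_Cmod_pow.
  intros n. rewrite sum_n_telescope.
  replace (H 0%nat - H (S n) - c) with (- H (S n)).
  2:{ replace (H 0%nat) with c; [ring|].
      unfold H, qpoch_ratio; simpl. field. }
  rewrite Cmod_opp. unfold H. rewrite Cmod_mult, Cmod_mult, Cmod_pow.
  rewrite Rmult_assoc. apply Rmult_le_compat_l; [apply Cmod_ge_0|].
  pose proof (Cmod_ge_0 x) as X0. pose proof (pow_le _ n X0).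
  apply Rmult_le_compat; [apply Cmod_ge_0|now apply pow_le| |].
  - now apply Cmod_qpoch_ratio_le, Cmod_ap_le.
  - simpl; nra.
Qed.

Lemma gauss_series_shift (a s : C) (n : nat) : (Cmod a <= 1)%R ->
  is_series (gauss_term x p a) s ->
  is_series (gauss_term x p (a * p ^ S n))
    (s + sum_n (fun i => x * (a * p ^ i) / (1 - x * (a * p ^ i))) n).
Proof using Hx Hp.
  intros Ha Hs. induction n as [|n IH].
  - rewrite sum_O, Cpow_1_r.
    replace (a * p ^ 0) with a by (simpl; ring).
    now apply gauss_series_step.
  - rewrite sum_Sn. change plus with Cplus. rewrite Cplus_assoc.
    replace (a * p ^ S (S n)) with (a * p ^ S n * p) by (simpl; ring).
    apply gauss_series_step; [|exact IH].
    pose proof (Cmod_mul_pow_le a p (S n)). lra.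
Qed.

(** [L] is [Phi(0)], and the bound is [O(|a|)]: continuity of [Phi] at 0. *)
Lemma gauss_series_near (a s L : C) : (Cmod a <= 1)%R ->
  is_series (gauss_term x p a) s ->
  is_series (fun j => x ^ S j / (1 - p ^ S j)) L ->
  (Cmod (s - L) <= B * Cmod a * (/ (1 - Cmod p) * / (1 - Cmod x)))%R.
Proof using Hx Hp.
  intros Ha Hs HL.
  apply (Cmod_series_le
    (fun j => gauss_term x p a j + (- (1)) * (x ^ S j / (1 - p ^ S j))) _
    (fun j => B * Cmod a * (/ (1 - Cmod p) * Cmod x ^ j))%R).
  - intros j. unfold gauss_term.
    replace (qpoch_ratio x p a (S j) * (x ^ S j / (1 - p ^ S j)) +
             - (1) * (x ^ S j / (1 - p ^ S j)))
      with ((qpoch_ratio x p a (S j) - 1) * (x ^ S j / (1 - p ^ S j))) by ring.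
    rewrite Cmod_mult. apply Rmult_le_compat; auto using Cmod_ge_0.
    + now apply Cmod_qpoch_ratio_minus_1_le.
    + now apply lambert_term_le.
  - replace (s - L) with (s + - (1) * L) by ring.
    apply is_series_C_plus; [exact Hs|]. now apply is_series_C_scal.
  - now apply is_series_R_scal, is_series_R_scal, is_series_Cmod_geom.
Qed.

Lemma ex_gauss_series (a : C) : (Cmod a <= 1)%R ->
  exists s : C, is_series (gauss_term x p a) s.
Proof using Hx Hp.
  intros Ha.
  apply (ex_series_C_le _ (fun j => (1 + B) * (/ (1 - Cmod p) * Cmod x ^ j))%R).
  - intros j. unfold gauss_term. rewrite Cmod_mult.
    apply Rmult_le_compat; auto using Cmod_ge_0.
    + now apply Cmod_qpoch_ratio_le.
    + now apply lambert_term_le.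
  - eexists. now apply is_series_R_scal, is_series_R_scal, is_series_Cmod_geom.
Qed.

Lemma ex_lambert_series :
  exists L : C, is_series (fun j => x ^ S j / (1 - p ^ S j)) L.
Proof using Hx Hp.
  apply (ex_series_C_le _ (fun j => / (1 - Cmod p) * Cmod x ^ j)%R).
  - intros j. now apply lambert_term_le.
  - eexists. now apply is_series_R_scal, is_series_Cmod_geom.
Qed.

(** Only [Phi(a)] and [Phi(0)] are summed by a comparison test; the second series
    gets both its convergence and its sum from its partial sums
    [Phi(a p^(n+1)) - Phi(a)]. *)
Theorem q_gauss_log_derivative (a : C) : (Cmod a <= 1)%R ->
  exists S1 S2 : C,
    is_series (fun i => x * p ^ i / (1 - x * p ^ i)) S1 /\
    is_series (fun i => x * (a * p ^ i) / (1 - x * (a * p ^ i))) S2 /\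
    is_series (gauss_term x p a) (S1 - S2).
Proof using Hx Hp.
  intros Ha.
  destruct ex_lambert_series as [L HL].
  destruct (ex_gauss_series a Ha) as [s Hs].
  exists L, (L - s). split; [now apply is_series_lambert|]. split.
  - set (c := (B * Cmod a * Cmod p * (/ (1 - Cmod p) * / (1 - Cmod x)))%R).
    apply (is_series_of_le _ _ (fun n => (c * Cmod p ^ n)%R)).
    2: now apply is_lim_seq_Cmod_pow.
    intros n.
    pose proof (gauss_series_shift a s n Ha Hs) as Hn.
    pose proof (Cmod_mul_pow_le a p (S n)) as Hapn.
    apply gauss_series_near with (L := L) in Hn; [|lra|exact HL].
    rewrite Cmod_mult, Cmod_pow in Hn.
    match goal with |- (Cmod (?A - _) <= _)%R =>
      replace (A - (L - s)) with (s + A - L) by ring end.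
    eapply Rle_trans; [exact Hn|]. unfold c; simpl; lra.
  - replace (L - (L - s)) with s by ring. exact Hs.
Qed.

End Gauss.

(** * Central q-binomial coefficients *)

Lemma qpoch_sq (q : C) (n : nat) :
  qpoch (q ^ 2) (q ^ 2) n = qpoch q q n * qpoch (- q) q n.
Proof.
  induction n as [|n IH]; cbn [qpoch]; [ring|].
  rewrite IH, <- Cpow_mult_r, Nat.mul_comm, Cpow_mult_r. simpl. ring.
Qed.

(** Separates the odd powers of [q] from the even ones. *)
Lemma qpoch_double (q : C) (n : nat) :
  qpoch q q (2 * n) = qpoch q (q ^ 2) n * qpoch (q ^ 2) (q ^ 2) n.
Proof.
  induction n as [|n IH]; [simpl; ring|].
  replace (2 * S n)%nat with (S (S (2 * n))) by lia.
  cbn [qpoch]. rewrite IH, (Cpow_S q (2 * n)), Cpow_mult_r. simpl. ring.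
Qed.

Lemma central_qbinom (q : C) (n : nat) : (Cmod q < 1)%R ->
  qbinom (q ^ 2) (2 * n) n / qpoch (- q) q (2 * n)
  = qpoch q (q ^ 2) n / qpoch (q ^ 2) (q ^ 2) n.
Proof.
  intros Hq. pose proof (Cmod_ge_0 q) as Q0.
  assert (Cmod (q ^ 2) < 1)%R as Hq2 by (rewrite Cmod_pow; simpl; nra).
  unfold qbinom. replace (n <=? 2 * n) with true
    by (symmetry; apply Nat.leb_le; lia).
  replace (2 * n - n)%nat with n by lia.
  rewrite qpoch_sq, qpoch_double. field. split.
  - apply qpoch_neq_0; lra.
  - apply qpoch_neq_0; [rewrite Cmod_opp|]; lra.
Qed.

(** The two q-Pochhammer symbols of length [m + j + 1] split at [m]; their tails
    start at [q * q^(2m) = a] and at [q^2 * q^(2m) = q a], which is the pair of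
    parameters [a] and [x a] with [x = q]. *)
Lemma central_term (q : C) (m j : nat) : (Cmod q < 1)%R ->
  qbinom (q ^ 2) (2 * (m + 1 + j)) (m + 1 + j) *
    (q ^ (m + 1 + j) /
     (qpoch (- q) q (2 * (m + 1 + j)) * qint (q ^ 2) (m + 1 + j - m)))
  = qbinom (q ^ 2) (2 * m) m * (q ^ m / qpoch (- q) q (2 * m)) * (1 - q ^ 2)
    * gauss_term q (q ^ 2) (q ^ (2 * m + 1)) j.
Proof.
  intros Hq. pose proof (Cmod_ge_0 q) as Q0.
  assert (Cmod (q ^ 2) < 1)%R as Hq2 by (rewrite Cmod_pow; simpl; nra).
  assert (forall n, qpoch (- q) q n <> 0) as N1.
  { intros n. apply qpoch_neq_0; [rewrite Cmod_opp|]; lra. }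
  assert (forall n, 1 - (q ^ 2) ^ S n <> 0) as N2.
  { intros n. apply one_minus_neq_0. pose proof (Cmod_pow_S_le (q ^ 2) n). lra. }
  assert (1 - q ^ 2 <> 0) as N3 by now apply one_minus_neq_0.
  replace (m + 1 + j - m)%nat with (S j) by lia.
  replace (m + 1 + j)%nat with (m + S j)%nat by lia.
  unfold qint, gauss_term, qpoch_ratio.
  transitivity (qbinom (q ^ 2) (2 * (m + S j)) (m + S j)
     / qpoch (- q) q (2 * (m + S j)) * q ^ (m + S j) * (1 - q ^ 2) / (1 - (q ^ 2) ^ S j)).
  { generalize (N1 (2 * (m + S j))%nat) (N2 j). intros D1 D2.
    field. auto. }
  rewrite central_qbinom by exact Hq.
  transitivity (qbinom (q ^ 2) (2 * m) m / qpoch (- q) q (2 * m) * q ^ m * (1 - q ^ 2)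
    * (qpoch (q ^ (2 * m + 1)) (q ^ 2) (S j) / qpoch (q * q ^ (2 * m + 1)) (q ^ 2) (S j)
       * (q ^ S j / (1 - (q ^ 2) ^ S j)))).
  2:{ unfold Cdiv; ring. }
  rewrite central_qbinom by exact Hq.
  rewrite !qpoch_add.
  replace (q * (q ^ 2) ^ m) with (q ^ (2 * m + 1))
    by (rewrite Cpow_add_r, Cpow_mult_r, Cpow_1_r; ring).
  replace (q ^ 2 * (q ^ 2) ^ m) with (q * q ^ (2 * m + 1))
    by (rewrite Cpow_add_r, Cpow_mult_r, Cpow_1_r; simpl; ring).
  rewrite (Cpow_add_r q m (S j)).
  assert (qpoch (q ^ 2) (q ^ 2) m <> 0) as N4 by (apply qpoch_neq_0; lra).
  assert (qpoch (q * q ^ (2 * m + 1)) (q ^ 2) (S j) <> 0) as N5.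
  { apply qpoch_neq_0; [|lra].
    pose proof (Cmod_mul_pow_le q q (2 * m + 1)). lra. }
  specialize (N2 j). revert N2. generalize ((q ^ 2) ^ S j) (q ^ S j).
  intros P Q N2. field. auto.
Qed.

Theorem theorem3p1 :
  forall (q : C), (0 < Cmod q < 1)%R ->
  forall (m : nat),
  exists S1 S2 : C,
    is_sum_from 1 (fun k : nat => q ^ (2 * k - 1) / qint q (2 * k - 1)) S1 /\
    is_sum_from 1 (fun k : nat => q ^ (2 * k + 2 * m) / qint q (2 * k + 2 * m)) S2 /\
    is_sum_from (m + 1)
      (fun k : nat =>
         qbinom (q ^ 2) (2 * k) k *
         (q ^ k / (qpoch (- q) q (2 * k) * qint (q ^ 2) (k - m))))
      (qbinom (q ^ 2) (2 * m) m *
       ((1 + q) * q ^ m / qpoch (- q) q (2 * m)) * (S1 - S2)).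
Proof.
  intros q [_ Hq] m. pose proof (Cmod_ge_0 q) as Q0.
  assert (Cmod (q ^ 2) < 1)%R as Hq2 by (rewrite Cmod_pow; simpl; nra).
  assert (forall n, 1 - q ^ S n <> 0) as N.
  { intros n. apply one_minus_neq_0. pose proof (Cmod_pow_S_le q n). lra. }
  assert (1 - q <> 0) as N0 by now apply one_minus_neq_0.
  assert (Cmod (q ^ (2 * m + 1)) <= 1)%R as Ha.
  { rewrite Cmod_pow. apply pow_le_1_compat; lra. }
  destruct (q_gauss_log_derivative q (q ^ 2) Hq Hq2 _ Ha)
    as (T1 & T2 & H1 & H2 & H3).
  exists ((1 - q) * T1), ((1 - q) * T2). unfold is_sum_from. repeat split.
  - apply (is_series_ext (fun i => (1 - q) * (q * (q ^ 2) ^ i / (1 - q * (q ^ 2) ^ i))));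
      [|now apply is_series_C_scal].
    intros i. unfold qint.
    (* Both sides are in terms of [y = q^(2i+1)], since [q (q^2)^i = y]. *)
    replace (2 * (1 + i) - 1)%nat with (S (2 * i)) by lia.
    replace (q * (q ^ 2) ^ i) with (q ^ S (2 * i))
      by (rewrite Cpow_S, Cpow_mult_r; reflexivity).
    specialize (N (2 * i)%nat). revert N. generalize (q ^ S (2 * i)).
    intros y D. change ((1 - q) * (y / (1 - y)) = y / ((1 - y) / (1 - q))).
    field. auto.
  - apply (is_series_ext (fun i =>
      (1 - q) * (q * (q ^ (2 * m + 1) * (q ^ 2) ^ i)
                 / (1 - q * (q ^ (2 * m + 1) * (q ^ 2) ^ i)))));
      [|now apply is_series_C_scal].
    intros i. unfold qint.
    replace (2 * (1 + i) + 2 * m)%nat with (S (2 * m + 1 + 2 * i)) by lia.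
    replace (q * (q ^ (2 * m + 1) * (q ^ 2) ^ i)) with (q ^ S (2 * m + 1 + 2 * i))
      by (rewrite Cpow_S, Cpow_add_r, (Cpow_mult_r q 2 i); reflexivity).
    specialize (N (2 * m + 1 + 2 * i)%nat). revert N.
    generalize (q ^ S (2 * m + 1 + 2 * i)).
    intros y D. change ((1 - q) * (y / (1 - y)) = y / ((1 - y) / (1 - q))).
    field. auto.
  - replace (qbinom (q ^ 2) (2 * m) m *
       ((1 + q) * q ^ m / qpoch (- q) q (2 * m)) * ((1 - q) * T1 - (1 - q) * T2))
      with (qbinom (q ^ 2) (2 * m) m * (q ^ m / qpoch (- q) q (2 * m)) * (1 - q ^ 2)
            * (T1 - T2)) by (unfold Cdiv; simpl; ring).
    eapply is_series_ext; [|apply is_series_C_scal, H3].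
    intros j. symmetry. now apply central_term.
Qed.
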